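(* Let $d\ge 0$ be an integer and let $S(2,d)$ be the Schur algebra over $\mathbb{Q}$ (defined in the context). Then $S(2,d)$ is isomorphic with the associative $\mathbb{Q}$-algebra with $1$ generated by $e,f,H_1$ subject to the relations $$H_1e-eH_1=e,\qquad ef-fe=2H_1-d,\qquad H_1f-fH_1=-f,$$ $$H_1(H_1-1)\cdots(H_1-d)=0.$$ Moreover, this presented algebra has a $\mathbb{Q}$-basis consisting of all $e^a H_1^b f^c$ with $a,b,c$ nonnegative integers such that $a+b+c\le d$.
   Context: Let $E$ be a $2$-dimensional $\mathbb{Q}$-vector space with fixed basis $e_1,e_2$, identifying $GL(E)$ with $GL_2(\mathbb{Q})$. The group $GL_2(\mathbb{Q})$ acts diagonally on $E^{\otimes d}$; extending linearly gives a representation of the group algebra $\mathbb{Q}GL_2(\mathbb{Q})\to\mathrm{End}(E^{\otimes d})$, and the Schur algebra $S(2,d)$ is its image. Equivalently, $S(2,d)$ is the image of the differentiated representation $\rho_d:U(\mathfrak{gl}_2)\to\mathrm{End}(E^{\otimes d})$ of the universal enveloping algebra. *)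

(* Defs.v *)
From HB Require Import structures.
From mathcomp Require Import all_boot all_order all_algebra.
From mathcomp Require Import mxtens.
Set Implicit Arguments. Unset Strict Implicit. Unset Printing Implicit Defensive.
Import GRing.Theory.
Local Open Scope ring_scope.

(* E = Q^2 with basis e1,e2; End(E^{(x)d}) = 'M[rat]_(2^d) via the Kronecker
   (tensor) basis.  tpow d g = g (x) ... (x) g (d factors) is the matrix of the
   diagonal action of g on E^{(x)d}. *)
Fixpoint tpow (d : nat) (g : 'M[rat]_2) : 'M[rat]_(2 ^ d) :=
  match d return 'M[rat]_(2 ^ d) with
  | 0 => 1%:M
  | d'.+1 => castmx (esym (expnSr 2 d'), esym (expnSr 2 d'))
                    (tensmx (tpow d' g) g)
  end.

(* The Schur algebra S(2,d): image of Q GL_2(Q) in End(E^{(x)d}),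
   i.e. the Q-linear span of the tpow d g, g invertible. *)
Definition in_schur (d : nat) (A : 'M[rat]_(2 ^ d)) : Prop :=
  exists s : seq (rat * 'M[rat]_2),
    all (fun p => p.2 \in unitmx) s /\ A = \sum_(p <- s) p.1 *: tpow d p.2.

Definition schur_hom (d : nat) (B : algType rat) (phi : 'M[rat]_(2 ^ d) -> B)
  : Prop :=
  [/\ phi 1%:M = 1,
      forall x y, in_schur x -> in_schur y -> phi (x + y) = phi x + phi y,
      forall (c : rat) x, in_schur x -> phi (c *: x) = c *: phi x &
      forall x y, in_schur x -> in_schur y -> phi (x *m y) = phi x * phi y].

Definition rels (d : nat) (B : algType rat) (e f H : B) : Prop :=
  [/\ H * e - e * H = e,
      e * f - f * e = 2%:R *: H - d%:R,
      H * f - f * H = - f &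
      \prod_(i < d.+1) (H - i%:R) = 0].

Definition mxpow (n : nat) (A : 'M[rat]_n) (k : nat) : 'M[rat]_n :=
  iter k (mulmx A) 1%:M.

Definition mx_rels (d : nat) (e f H : 'M[rat]_(2 ^ d)) : Prop :=
  [/\ H *m e - e *m H = e,
      e *m f - f *m e = 2%:R *: H - d%:R%:M,
      H *m f - f *m H = - f &
      \big[mulmx/1%:M]_(i < d.+1) (H - i%:R%:M) = 0].

Definition mono (n : nat) (e f H : 'M[rat]_n) (a b c : nat) : 'M[rat]_n :=
  mxpow e a *m mxpow H b *m mxpow f c.

(* Main.v *)
(** The straightening rules of a presented algebra write it as the span of the
    e^a p(H) f^c.  Multiplying H(H-1)...(H-d) = 0 repeatedly by e and taking
    differences kills e^a H(H-1)...(H-b+1) for a+b = d+1, and bracketing with f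
    then lowers every e^a H^b f^c with a+b+c = d+1, so the monomials of degree
    at most d span.  In End(E^{(x)d}) they are independent: peeling off the last
    tensor factor, whose matrix units E12 and E21 pick out a e^(a-1) H^b f^c and
    c e^a H^b f^(c-1), reduces d+1 to d, and what remains is a polynomial in H
    of degree at most d vanishing at 0, ..., d.  Spanning in the product algebra
    S(2,d) x B together with independence in the first factor shows that the
    span of the pairs of monomials is the graph of a morphism S(2,d) -> B.
    Finally g (x) ... (x) g lies in the span of the monomials by the LDU
    factorization of g, and e, f, H are combinations of such powers by inverting
    a Vandermonde matrix. *)
Require Import Defs.
From Stdlib Require Import ClassicalEpsilon.
From HB Require Import structures.
From mathcomp Require Import all_boot all_order all_algebra.
From mathcomp Require Import mxtens zify ring.
Set Implicit Arguments. Unset Strict Implicit. Unset Printing Implicit Defensive.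
Import GRing.Theory.
Local Open Scope ring_scope.

(* [{poly rat}] without the [reverse_coercion] left in its elaboration, which
   would make [lia] distinguish convertible sizes. *)
Local Notation polyQ := (polynomial rat_rat__canonical__GRing_NzSemiRing).

(** * The difference operator and falling factorials *)

Definition shift (p : polyQ) : polyQ := p \Po ('X + 1%:P).

Lemma size_shift p : size (shift p) = size p.
Proof. exact: size_comp_poly2 (size_XaddC _). Qed.

(** Substituting X + 1 keeps degree and leading coefficient, so the top terms cancel. *)
Lemma size_shiftB p : (size (shift p - p)%R <= (size p).-1)%N.
Proof.
have lead_shift : lead_coef (shift p) = lead_coef p.
  by rewrite lead_coef_comp ?size_XaddC // lead_coefXaddC expr1n mulr1.
apply/leq_sizeP => j; rewrite leq_eqVlt => /orP[/eqP <-|lt_j].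
  by move: lead_shift; rewrite coefB /lead_coef size_shift => ->; rewrite subrr.
have le_j : (size p <= j)%N by move: lt_j; case: (size p).
by rewrite coefB !nth_default ?size_shift ?subr0.
Qed.

(** The falling factorial X(X-1)...(X-b+1): the difference operator acts on these as differentiation
    acts on powers. *)
Definition ffpoly (b : nat) : polyQ := \prod_(i < b) ('X - i%:R%:P).

Lemma size_ffpoly b : size (ffpoly b) = b.+1.
Proof. by rewrite size_prod_XsubC /= /index_enum -enumT size_enum_ord. Qed.

Lemma ffpoly_monic b : ffpoly b \is monic.
Proof. by apply: monic_prod => i _; apply: monicXsubC. Qed.

(** Both terms on the left share the factor [ffpoly b]; the cofactors X + 1 and X - b differ by b +
    1. *)
Lemma shift_ffpolyB b : shift (ffpoly b.+1) - ffpoly b.+1 = b.+1%:R *: ffpoly b.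
Proof.
have -> : shift (ffpoly b.+1) = ('X + 1%:P) * ffpoly b.
  rewrite /ffpoly big_ord_recl /shift comp_polyM rmorph_prod /=.
  rewrite subr0 comp_polyX; congr (_ * _); apply: eq_bigr => i _.
  rewrite comp_polyB comp_polyX comp_polyC /bump /= -natr1 polyCD opprD.
  by ring.
rewrite {2}/ffpoly big_ord_recr /= -/(ffpoly b) -mul_polyC -natr1 polyCD.
by ring.
Qed.

Lemma size_linear_mul (k s t : rat) (p : polyQ) :
  (size (k *: (s *: 'X + t%:P) * p)%R <= (size p).+1)%N.
Proof.
have size_lin : (size (k *: (s *: 'X + t%:P))%R <= 2)%N.
  apply: leq_trans (size_scale_leq _ _) (leq_trans (size_polyD _ _) _).
  rewrite geq_max (leq_trans (size_scale_leq _ _)) ?size_polyX //.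
  exact: leq_trans (size_polyC_leq1 _) _.
by apply: leq_trans (size_polyMleq _ _) _; lia.
Qed.

(** * Spans of monomials e^a p(H) f^c in an arbitrary algebra *)

Section MonomialSpan.
Variables (B : algType rat) (e f H : B).

Definition polyev (p : polyQ) : B := horner_alg H p.
Definition pmon (a : nat) (p : polyQ) (c : nat) : B := e ^+ a * polyev p * f ^+ c.

(* The span of the e^a H^b f^c with a + b + c <= m: recall that [size p] is the
   degree of [p] plus one. *)
Inductive mspan (m : nat) : B -> Prop :=
| mspan0 : mspan m 0
| mspan_cons x a (p : polyQ) c : (size p + (a + c) <= m.+1)%N -> mspan m x ->
    mspan m (x + pmon a p c).

Lemma polyev_is_additive : additive polyev. Proof. exact: raddfB. Qed.
HB.instance Definition _ := GRing.isZmodMorphism.Build _ _ polyev polyev_is_additive.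

Lemma polyevM p q : polyev (p * q) = polyev p * polyev q. Proof. exact: rmorphM. Qed.
Lemma polyevZ s p : polyev (s *: p) = s *: polyev p.
Proof. by rewrite -mul_polyC polyevM {1}/polyev horner_algC mulr_algl. Qed.
Lemma polyevX : polyev 'X = H. Proof. exact: horner_algX. Qed.
Lemma polyevC s : polyev s%:P = s *: 1. Proof. exact: horner_algC. Qed.
Lemma polyev1 : polyev 1 = 1. Proof. exact: rmorph1. Qed.

Lemma pmonD a p q c : pmon a (p + q) c = pmon a p c + pmon a q c.
Proof. by rewrite /pmon raddfD mulrDr mulrDl. Qed.
Lemma pmonZ a s p c : pmon a (s *: p) c = s *: pmon a p c.
Proof. by rewrite /pmon polyevZ -scalerAr -scalerAl. Qed.
Lemma pmon0 a c : pmon a 0 c = 0.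
Proof. by rewrite /pmon raddf0 mulr0 mul0r. Qed.

Lemma mspan_mon m a (p : polyQ) c :
  (size p + (a + c) <= m.+1)%N -> mspan m (pmon a p c).
Proof. by move=> le_m; rewrite -[pmon _ _ _]add0r; constructor=> //; left. Qed.

Lemma mspanD m x y : mspan m x -> mspan m y -> mspan m (x + y).
Proof.
move=> Lx; elim=> [|y' a p c le_m _ IH]; first by rewrite addr0.
by rewrite addrA; constructor.
Qed.

Lemma mspanZ m s x : mspan m x -> mspan m (s *: x).
Proof.
elim=> [|y a p c le_m _ IH]; first by rewrite scaler0; left.
rewrite scalerDr -pmonZ; constructor=> //.
exact: leq_trans (leq_add (size_scale_leq _ _) (leqnn _)) le_m.
Qed.

Lemma mspanN m x : mspan m x -> mspan m (- x).
Proof. by rewrite -scaleN1r; apply: mspanZ. Qed.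

Lemma mspanB m x y : mspan m x -> mspan m y -> mspan m (x - y).
Proof. by move=> Lx /mspanN; apply: mspanD. Qed.

Lemma mspan_sum m (I : Type) (r : seq I) (P : pred I) F :
  (forall i, P i -> mspan m (F i)) -> mspan m (\sum_(i <- r | P i) F i).
Proof. by move=> LF; apply: big_ind => //; [left | apply: mspanD]. Qed.

Lemma mspan_map m n (g : {additive B -> B}) :
  (forall a (p : polyQ) c, (size p + (a + c) <= m.+1)%N ->
    mspan n (g (pmon a p c))) ->
  forall x, mspan m x -> mspan n (g x).
Proof.
move=> Lg x; elim=> [|y a p c le_m _ IH]; first by rewrite raddf0; left.
by rewrite raddfD; apply: mspanD; last exact: Lg.
Qed.

Lemma mspan_subalg m (Q : B -> Prop) : Q 1 ->
  (forall x y, Q x -> Q y -> Q (x + y)) -> (forall s x, Q x -> Q (s *: x)) ->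
  (forall x y, Q x -> Q y -> Q (x * y)) -> Q e -> Q f -> Q H ->
  forall x, mspan m x -> Q x.
Proof.
move=> Q1 QD QZ QM Qe Qf QH.
have Q0 : Q 0 by rewrite -(scale0r 1); apply: QZ.
have QX z n : Q z -> Q (z ^+ n).
  by move=> Qz; elim: n => [|n IH]; rewrite ?expr0 ?exprS; [|apply: QM].
move=> x; elim=> [//|y a p c _ _ Qy]; apply: (QD) => //.
apply: (QM); [apply: (QM); [exact: QX|] | exact: QX].
elim/poly_ind: p => [|p s IH]; first by rewrite raddf0.
rewrite raddfD /= polyevM polyevX polyevC.
by apply: (QD); [apply: (QM) | apply: (QZ)].
Qed.

End MonomialSpan.

(** * Straightening under the relations *)

Section Straightening.
Variables (d : nat) (B : algType rat) (e f H : B).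
Hypothesis rel : rels d e f H.

Notation ev := (polyev H).
Notation mon := (pmon e f H).
Notation L := (mspan e f H).

Lemma mulHe : H * e = e * (H + 1).
Proof. by case: rel => He _ _ _; rewrite mulrDr mulr1 -{3}He addrC subrK. Qed.

Lemma mulfH : f * H = (H + 1) * f.
Proof.
case: rel => _ _ /eqP Hf _; move: Hf; rewrite subr_eq mulrDl mul1r => /eqP ->.
by rewrite addrAC addNr add0r.
Qed.

Lemma ev_mule p : ev p * e = e * ev (shift p).
Proof.
rewrite /shift; elim/poly_ind: p => [|p s IH].
  by rewrite comp_poly0 raddf0 mulr0 mul0r.
rewrite comp_polyD comp_polyM comp_polyX comp_polyC !raddfD /= !polyevM !polyevC.
rewrite !raddfD /= polyevX polyev1 mulrDl mulrDr -mulrA mulHe mulrA IH mulrA.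
by rewrite -scalerAl -scalerAr mul1r mulr1.
Qed.

Lemma mulf_ev p : f * ev p = ev (shift p) * f.
Proof.
rewrite /shift; elim/poly_ind: p => [|p s IH].
  by rewrite comp_poly0 raddf0 mulr0 mul0r.
rewrite comp_polyD comp_polyM comp_polyX comp_polyC !raddfD /= !polyevM !polyevC.
rewrite !raddfD /= polyevX polyev1 mulrDl mulrDr mulrA IH -!mulrA mulfH.
by rewrite -scalerAl -scalerAr mul1r mulr1.
Qed.

Lemma mulH_exp a : H * e ^+ a = e ^+ a * (H + a%:R).
Proof.
elim: a => [|a IH]; first by rewrite mulr1 mul1r addr0.
rewrite exprSr mulrA IH -!mulrA mulrDl mulHe -(commr_nat e a) -mulrDr.
by rewrite -addrA -nat1r.
Qed.

(** Each of the a + 1 swaps of f with e costs 2H - d; carrying this to the right of the remaining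
    e's shifts H by 0, ..., a, and these terms add up to (a + 1)(2H + a - d). *)
Lemma mulf_exp a : f * e ^+ a.+1 = e ^+ a.+1 * f
  - e ^+ a * ev (a.+1%:R *: (2%:R *: 'X + (a%:R - d%:R)%:P)).
Proof.
case: rel => _ ef _ _.
have fe : f * e = e * f - (2%:R *: H - d%:R) by rewrite -ef opprB addrC subrK.
have evlin k s : ev (k *: (2%:R *: 'X + s%:P)) = k *: (2%:R *: H + s *: 1).
  by rewrite polyevZ raddfD /= polyevZ polyevX polyevC.
elim: a => [|a IH].
  by rewrite expr1 expr0 mul1r evlin fe scale1r sub0r scaleNr !scaler_nat.
set y := e ^+ a.+1 in IH *; have -> : e ^+ a.+2 = e * y by rewrite -exprS.
rewrite mulrA fe mulrBl -[e * f * y]mulrA IH evlin mulrBr [e * (y * f)]mulrA.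
rewrite -addrA; congr (_ + _); rewrite -opprD evlin; congr (- _).
rewrite mulrA -exprS -/y mulrBl -scalerAl mulH_exp -/y -!scaler_nat.
rewrite -scalerAl mul1r -!scalerAr !mulrDr -!scalerAr !mulr1.
rewrite !scalerDr !scalerA -!addrA addrA addrACA -!scalerBl -!scalerDl.
by congr (_ *: _ + _ *: _); ring.
Qed.

(* For [a = 0] the junk exponent [a.-1] is harmless: its coefficient vanishes. *)
Lemma commf_mon a p c :
  f * mon a p c - mon a p c * f = mon a (shift p - p) c.+1
    - mon a.-1 (a%:R *: (2%:R *: 'X + (a.-1%:R - d%:R)%:P) * p) c.
Proof.
have fmon0 : f * ev p * f ^+ c = ev (shift p) * f ^+ c.+1.
  by rewrite mulf_ev -mulrA -exprS.
have monf : mon a p c * f = mon a p c.+1 by rewrite /pmon -mulrA -exprSr.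
rewrite monf /pmon raddfB mulrBr mulrBl -/(mon a p c.+1).
case: a {monf} => [|a].
  by rewrite /= scale0r mul0r raddf0 mulr0 mul0r subr0 !mul1r mulrA fmon0.
rewrite !mulrA mulf_exp polyevM !mulrBl -!mulrA [f * (_ * _)]mulrA fmon0.
by rewrite addrAC.
Qed.

(** In [commf_mon] one term raises c but lowers the degree of p, the other lowers a and multiplies p
    by a linear factor: the total degree does not grow. *)
Lemma mspan_commf m x : L m x -> L m (f * x - x * f).
Proof.
have add_g : additive (fun x => f * x - x * f).
  move=> u v; rewrite mulrBr mulrBl !opprB [v * f - u * f]addrC addrACA.
  by rewrite [v * f - _]addrC.
pose g : {additive B -> B} := HB.pack (fun x => f * x - x * f)
  (GRing.isZmodMorphism.Build _ _ _ add_g).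
apply: (@mspan_map _ _ _ _ m m g) => a p c le_m /=; rewrite commf_mon.
(* For p = 0 the size bound allows a + c = m + 1, and raising c would exceed it. *)
have [->|p0] := eqVneq p 0.
  by rewrite mulr0 /shift comp_poly0 subr0 !pmon0 subr0; left.
have p_gt0 : (0 < size p)%N by rewrite size_poly_gt0.
apply: mspanB; apply: mspan_mon; first by have := size_shiftB p; lia.
case: a le_m => [|a] le_m; first by rewrite scale0r mul0r size_poly0; lia.
by apply: leq_trans (leq_add (size_linear_mul _ _ _ _) (leqnn _)) _; lia.
Qed.

(** Induction on a from the relation H(H-1)...(H-d) = 0. If e^a [ffpoly b.+1](H) = 0, multiplying by
    e on the right gives the shifted polynomial, on the left the same one; the difference is (b + 1)
    e^(a+1) [ffpoly b](H). *)
Lemma mon_ffpoly a b : (a + b = d.+1)%N -> e ^+ a * ev (ffpoly b) = 0.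
Proof.
elim: a b => [|a IH] b; last rewrite addSnnS => /IH eq0.
  rewrite add0n => ->; rewrite mul1r /ffpoly /polyev rmorph_prod /=.
  case: rel => _ _ _ <-; apply: eq_bigr => i _.
  by rewrite -/(polyev _ _) raddfB /= polyevX polyevC scaler_nat.
have eq0' : e ^+ a.+1 * ev (shift (ffpoly b.+1)) = 0.
  by rewrite exprSr -mulrA -ev_mule mulrA eq0 mul0r.
have : e ^+ a.+1 * ev (b.+1%:R *: ffpoly b) = 0.
  by rewrite -shift_ffpolyB raddfB mulrBr eq0' exprS -mulrA eq0 mulr0 subr0.
rewrite polyevZ -scalerAr => /eqP; rewrite scaler_eq0 Num.Theory.pnatr_eq0 /=.
by move/eqP.
Qed.

(* Only the leading term of [p] matters modulo lower monomials. *)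
Lemma mspan_lead m a (p : polyQ) c : (size p + (a + c) <= m.+2)%N ->
  (forall b, (a + b + c = m.+1)%N -> L m (mon a (ffpoly b) c)) -> L m (mon a p c).
Proof.
move=> le_m Lff.
have [le_m1|gt_m1] := leqP (size p + (a + c)) m.+1; first exact: mspan_mon.
have [|p_gt0] := posnP (size p).
  by move/eqP; rewrite size_poly_eq0 => /eqP ->; rewrite pmon0; left.
have size_p : size p = (size p).-1.+1 by rewrite prednK.
have -> : mon a p c = mon a (p - lead_coef p *: ffpoly (size p).-1) c
    + lead_coef p *: mon a (ffpoly (size p).-1) c.
  by rewrite -pmonZ -pmonD subrK.
apply: mspanD; last by apply: mspanZ; apply: Lff; lia.
apply: mspan_mon; apply: (@leq_trans ((size p).-1 + (a + c))); last by lia.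
rewrite leq_add2r.
apply/leq_sizeP => j; rewrite leq_eqVlt => /orP[/eqP <-|lt_j].
  have := ffpoly_monic (size p).-1; rewrite monicE /lead_coef size_ffpoly => /eqP lc.
  by rewrite coefB coefZ lc mulr1 subrr.
have le_j : (size p <= j)%N by rewrite size_p.
by rewrite coefB coefZ !nth_default ?size_ffpoly ?mulr0 ?subr0.
Qed.

(** Induction on c, for all a and p. The case c = 0 is [mon_ffpoly]. Otherwise bracket e^a
    [ffpoly b.+1](H) f^c, reducible by induction, with f: this yields (b + 1) e^a [ffpoly b](H)
    f^(c+1) and a term in f^c that is again reducible. *)
Lemma mspan_top c a (p : polyQ) :
  (size p + (a + c) <= d.+2)%N -> L d (mon a p c).
Proof.
elim: c a p => [|c IH] a p le_d; apply: mspan_lead le_d _ => b eq_d.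
  by rewrite /pmon mon_ffpoly; [rewrite mul0r; left | lia].
have Lm : L d (mon a (ffpoly b.+1) c).
  by apply: IH; rewrite size_ffpoly; lia.
have : L d (mon a (shift (ffpoly b.+1) - ffpoly b.+1) c.+1).
  rewrite -[mon _ _ _](subrK (mon a.-1
    (a%:R *: (2%:R *: 'X + (a.-1%:R - d%:R)%:P) * ffpoly b.+1) c)).
  rewrite -commf_mon; apply: mspanD; first exact: mspan_commf.
  case: a {Lm} eq_d => [|a] eq_d; first by rewrite scale0r mul0r pmon0; left.
  apply: IH; apply: leq_trans (leq_add (size_linear_mul _ _ _ _) (leqnn _)) _.
  by rewrite size_ffpoly; lia.
rewrite shift_ffpolyB pmonZ => /(mspanZ b.+1%:R^-1).
by rewrite scalerA mulVf ?scale1r // Num.Theory.pnatr_eq0.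
Qed.

(** A generator raises the degree by at most one, so this collapse makes the span of degree d stable
    under multiplication. *)
Lemma mspan_succ x : L d.+1 x -> L d x.
Proof.
by elim=> [|y a p c le_d _ IH]; [left | apply: mspanD => //; apply: mspan_top].
Qed.

Lemma mspan1 : L d 1.
Proof.
rewrite -[1](_ : mon 0 1 0 = 1); first by apply: mspan_mon; rewrite size_poly1.
by rewrite /pmon polyev1 !mulr1.
Qed.

Lemma mspan_mule x : L d x -> L d (e * x).
Proof.
move=> Lx; apply: mspan_succ.
apply: (@mspan_map _ e f H d d.+1 (e \*o idfun) _ x Lx).
move=> a p c le_d; rewrite /= /pmon !mulrA -exprS; apply: mspan_mon; lia.
Qed.

Lemma mspan_mulH x : L d x -> L d (H * x).
Proof.
move=> Lx; apply: mspan_succ.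
apply: (@mspan_map _ e f H d d.+1 (H \*o idfun) _ x Lx).
move=> a p c le_d; rewrite /= /pmon !mulrA mulH_exp -[_ * _ * ev p]mulrA.
have -> : H + a%:R = ev ('X + a%:R%:P).
  by rewrite raddfD /= polyevX polyevC scaler_nat.
rewrite -polyevM; apply: mspan_mon.
have : (size (('X + (a%:R)%:P) * p)%R <= (size p).+1)%N.
  by apply: leq_trans (size_polyMleq _ _) _; rewrite size_XaddC.
lia.
Qed.

Lemma mspan_mulf x : L d x -> L d (f * x).
Proof.
(* The bracket keeps the degree, and right multiplication by f only raises c. *)
move=> Lx; rewrite -(subrK (x * f) (f * x)); apply: mspanD.
  exact: mspan_commf.
apply: mspan_succ.
apply: (@mspan_map _ e f H d d.+1 (f \o* idfun) _ x Lx) => a p c le_d.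
rewrite /= /pmon -mulrA -exprSr; apply: mspan_mon; lia.
Qed.

Lemma mspan_mul x y : L d x -> L d y -> L d (x * y).
Proof.
move=> Lx Ly; elim: Lx => [|x' a p c _ _ IH]; first by rewrite mul0r; left.
rewrite mulrDl; apply: mspanD => // {IH}; rewrite /pmon -!mulrA.
have pow g n z : (forall z, L d z -> L d (g * z)) -> L d z -> L d (g ^+ n * z).
  move=> Lg Lz; elim: n => [|n IHn]; first by rewrite mul1r.
  by rewrite exprS -mulrA; apply: Lg.
apply: (pow) mspan_mule _; have := pow f c y mspan_mulf Ly.
move: (f ^+ c * y) => z Lz; elim/poly_ind: p => [|p s IH].
  by rewrite raddf0 mul0r; left.
(* X commutes with p, so H can be made the leftmost factor. *)
rewrite mulrC raddfD /= polyevM polyevX polyevC mulrDl -scalerAl mul1r -mulrA.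
by apply: mspanD; [apply: mspan_mulH | apply: mspanZ].
Qed.

Lemma mspan_e : L d e. Proof. by have := mspan_mule mspan1; rewrite mulr1. Qed.
Lemma mspan_f : L d f. Proof. by have := mspan_mulf mspan1; rewrite mulr1. Qed.
Lemma mspan_H : L d H. Proof. by have := mspan_mulH mspan1; rewrite mulr1. Qed.

End Straightening.

(** * The algebra End(E^{(x)d}) and its last tensor factor *)

(* An alias, because ['M_(2 ^ d)] carries no instance of nontrivial ring, as
   [2 ^ d] is not syntactically a successor. *)
Definition tensEnd (d : nat) : Type := 'M[rat]_(2 ^ d).

HB.instance Definition _ d := GRing.PzRing.on (tensEnd d).
HB.instance Definition _ d := GRing.Lmodule.on (tensEnd d).

Lemma tensEnd_nonzero1 d : 1 != 0 :> tensEnd d.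
Proof.
have gt0 : (0 < 2 ^ d)%N by rewrite expn_gt0.
apply/negP => /eqP/matrixP/(_ (Ordinal gt0) (Ordinal gt0)).
by rewrite !mxE eqxx.
Qed.
HB.instance Definition _ d :=
  GRing.PzSemiRing_isNonZero.Build (tensEnd d) (@tensEnd_nonzero1 d).

Lemma tensEnd_scalerAl d s (x y : tensEnd d) : s *: (x * y) = s *: x * y.
Proof. exact: scalemxAl. Qed.
HB.instance Definition _ d :=
  GRing.Lmodule_isLalgebra.Build rat (tensEnd d) (@tensEnd_scalerAl d).

Lemma tensEnd_scalerAr d s (x y : tensEnd d) : s *: (x * y) = x * (s *: y).
Proof. exact: scalemxAr. Qed.
HB.instance Definition _ d :=
  GRing.Lalgebra_isAlgebra.Build rat (tensEnd d) (@tensEnd_scalerAr d).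

HB.lock Definition tens d (x : tensEnd d) (g : 'M[rat]_2) : tensEnd d.+1 :=
  castmx (esym (expnSr 2 d), esym (expnSr 2 d)) (tensmx x g).

(* Contracts the last tensor factor with its (i, j) matrix coefficient. *)
Definition slice d (i j : 'I_2) (x : tensEnd d.+1) : tensEnd d :=
  \matrix_(k, l) castmx (expnSr 2 d, expnSr 2 d) x
     (mxtens_index (k, i)) (mxtens_index (l, j)).

Lemma slice_is_linear d i j : linear (@slice d i j).
Proof.
move=> s x y; apply/matrixP => k l; rewrite !mxE !castmxE.
by rewrite !mxE.
Qed.
HB.instance Definition _ d i j := GRing.isLinear.Build rat (tensEnd d.+1)
  (tensEnd d) _ (@slice d i j) (@slice_is_linear d i j).

Lemma slice_tens d i j (x : tensEnd d) g : slice i j (tens x g) = g i j *: x.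
Proof.
apply/matrixP => k l; rewrite [LHS]mxE [RHS]mxE unlock castmxKV tensmxE mulrC.
by [].
Qed.

(** Indices of the product basis split into pairs, so every entry of x is an entry of some slice.
    Identities between tensors can thus be checked slice by slice. *)
Lemma slice_inj d (x y : tensEnd d.+1) :
  (forall i j, slice i j x = slice i j y) -> x = y.
Proof.
move=> eq_xy; apply: (can_inj (castmxK (expnSr 2 d) (expnSr 2 d))).
apply/matrixP => k l.
rewrite -[k]mxtens_unindexK -[l]mxtens_unindexK.
case: (mxtens_unindex k) (mxtens_unindex l) => [{}k i] [{}l j].
by have /matrixP/(_ k l) := eq_xy i j; rewrite !mxE.
Qed.

Lemma tensDl d (x y : tensEnd d) g : tens (x + y) g = tens x g + tens y g.
Proof. by apply: slice_inj => i j; rewrite linearD /= !slice_tens scalerDr. Qed.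
Lemma tensDr d (x : tensEnd d) g h : tens x (g + h) = tens x g + tens x h.
Proof. by apply: slice_inj => i j; rewrite linearD /= !slice_tens mxE scalerDl. Qed.
Lemma tensZl d s (x : tensEnd d) g : tens (s *: x) g = s *: tens x g.
Proof. by apply: slice_inj => i j; rewrite linearZ /= !slice_tens !scalerA mulrC. Qed.
Lemma tensZr d s (x : tensEnd d) g : tens x (s *: g) = s *: tens x g.
Proof. by apply: slice_inj => i j; rewrite linearZ /= !slice_tens mxE scalerA. Qed.
Lemma tens0l d g : tens (0 : tensEnd d) g = 0.
Proof. by apply: slice_inj => i j; rewrite linear0 slice_tens scaler0. Qed.
Lemma tens0r d (x : tensEnd d) : tens x 0 = 0.
Proof. by apply: slice_inj => i j; rewrite linear0 slice_tens mxE scale0r. Qed.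
Lemma tensBr d (x : tensEnd d) g h : tens x (g - h) = tens x g - tens x h.
Proof. by rewrite tensDr -scaleN1r tensZr scaleN1r. Qed.
Lemma tensBl d (x y : tensEnd d) g : tens (x - y) g = tens x g - tens y g.
Proof. by rewrite tensDl -scaleN1r tensZl scaleN1r. Qed.
Lemma tens1 d : tens (1 : tensEnd d) 1 = 1.
Proof.
apply: slice_inj => i j; rewrite slice_tens; apply/matrixP => k l.
rewrite !mxE castmxE mxE (inj_eq (@cast_ord_inj _ _ _)).
by rewrite (can_eq (@mxtens_indexK _ _)) xpair_eqE -natrM mulnb andbC.
Qed.
Lemma tensM d (x y : tensEnd d) g h : tens x g * tens y h = tens (x * y) (g * h).
Proof.
have cM n n' (E : n = n') (A C : 'M[rat]_n) :
    castmx (E, E) (A *m C) = castmx (E, E) A *m castmx (E, E) C by case: n' / E.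
rewrite unlock; exact: etrans (esym (cM _ _ _ _ _)) (congr1 _ (tensmx_mul _ _ _ _)).
Qed.

(** * The differentiated action of gl_2 and its relations *)

(** This is rho_d(X): the sum over the d tensor factors of X acting in that factor. *)
Fixpoint liediag (d : nat) (X : 'M[rat]_2) : tensEnd d :=
  if d is d'.+1 then tens (liediag d' X) 1 + tens 1 X else 0.

Lemma liediagD d X Y : liediag d (X + Y) = liediag d X + liediag d Y.
Proof.
elim: d => [|d IH] /=; first by rewrite addr0.
by rewrite IH tensDl tensDr addrACA.
Qed.
Lemma liediagZ d s X : liediag d (s *: X) = s *: liediag d X.
Proof.
elim: d => [|d IH] /=; first by rewrite scaler0.
by rewrite IH tensZl tensZr scalerDr.
Qed.
Lemma liediagB d X Y : liediag d (X - Y) = liediag d X - liediag d Y.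
Proof. by rewrite liediagD -scaleN1r liediagZ scaleN1r. Qed.
Lemma liediag1 d : liediag d 1 = d%:R.
Proof.
elim: d => [//|d IH] /=.
by rewrite IH -scaler_nat tensZl tens1 -natr1 scaler_nat.
Qed.

(** Terms with X and Y in different tensor factors commute and cancel from the bracket. *)
Lemma liediag_bracket d X Y : liediag d X * liediag d Y - liediag d Y * liediag d X
  = liediag d (X * Y - Y * X).
Proof.
elim: d => [|d IH] /=; first by rewrite mulr0 subr0.
rewrite -IH tensBl tensBr !mulrDl !mulrDr !tensM !mul1r !mulr1.
set a := tens _ 1; set b := tens _ X; set c := tens _ Y; set u := tens 1 (X * Y).
set a' := tens _ 1; set u' := tens 1 _.
have -> : a + c + (b + u) = (a + u) + (b + c).
  by rewrite [b + u]addrC addrACA [c + b]addrC.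
have -> : a' + b + (c + u') = (a' + u') + (b + c).
  by rewrite [c + u']addrC addrACA.
by rewrite [in LHS]opprD addrACA subrr addr0 opprD addrACA.
Qed.

Local Notation E11 := (delta_mx ord0 ord0 : 'M[rat]_2).
Local Notation E12 := (delta_mx ord0 ord_max : 'M[rat]_2).
Local Notation E21 := (delta_mx ord_max ord0 : 'M[rat]_2).
Local Notation E22 := (delta_mx ord_max ord_max : 'M[rat]_2).

Definition opE d : tensEnd d := liediag d E12.
Definition opF d : tensEnd d := liediag d E21.
(** E11 rather than E11 - E22: as E11 + E22 acts by d, the bracket of [opE] and [opF] becomes 2H -
    d. *)
Definition opH d : tensEnd d := liediag d E11.

Local Notation evd d := (@polyev (tensEnd d) (opH d)).
Local Notation mond d := (@pmon (tensEnd d) (opE d) (opF d) (opH d)).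
Local Notation L d := (@mspan (tensEnd d) (opE d) (opF d) (opH d) d).

Lemma E11DE22 : E11 + E22 = 1.
Proof.
apply/matrixP => i j; rewrite !mxE.
by case: i => [[|[|[]]] ?] //; case: j => [[|[|[]]] ?].
Qed.

Lemma delta_mulE (i j k l : 'I_2) : delta_mx i j * delta_mx k l
  = delta_mx i l *+ (j == k) :> 'M[rat]_2.
Proof. exact: mul_delta_mx_cond. Qed.

(** On the last factor E11 has eigenvalue 1 on e1 and 0 on e2, so H becomes H + 1 on one block and
    stays H on the other. *)
Lemma polyev_tens d p :
  evd d.+1 p = tens (evd d (shift p)) E11 + tens (evd d p) E22.
Proof.
rewrite /shift; elim/poly_ind: p => [|p s IH].
  by rewrite comp_poly0 !raddf0 !tens0l addr0.
rewrite comp_polyD comp_polyM comp_polyX comp_polyC !raddfD /= !polyevM !polyevC.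
have -> : opH d.+1 = tens (opH d) 1 + tens 1 E11 by [].
rewrite raddfD /= !polyevX polyevC IH scale1r -E11DE22 !tensDr.
rewrite !mulrDr !mulrDl !tensM !delta_mulE /= !mulr1n !mulr0n !tens0r !mulr1.
rewrite !tensDl !tensZl !add0r !addr0 -(tens1 d) -E11DE22 tensDr scalerDr.
by rewrite [RHS]addrACA; congr (_ + _); rewrite addrAC.
Qed.

(** H is diagonal with eigenvalues 0, ..., d: by [polyev_tens] each new factor adds to the spectrum
    its translate by 1. *)
Lemma polyev_eq0 d p :
  evd d p = 0 <-> (forall i, (i <= d)%N -> p.[i%:R] = 0).
Proof.
elim: d p => [|d IH] p.
  have -> : evd 0 p = p.[0] *: 1.
    elim/poly_ind: p => [|p s IH]; first by rewrite raddf0 horner0 scale0r.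
    rewrite raddfD /= polyevM polyevX /opH /= mulr0 add0r polyevC.
    by rewrite hornerMXaddC mulr0 add0r.
  split=> [/eqP|p0]; last by rewrite (p0 0%N) ?scale0r.
  by rewrite scaler_eq0 oner_eq0 orbF => /eqP p0 [].
have hs i : (shift p).[i%:R] = p.[i.+1%:R].
  by rewrite horner_comp hornerD hornerX hornerC natr1.
split=> [ev0 i le_i|p0].
  have := congr1 (slice ord0 ord0) ev0; have := congr1 (slice ord_max ord_max) ev0.
  rewrite polyev_tens !linearD !linear0 /= !slice_tens !mxE /= !scale0r !scale1r.
  rewrite add0r addr0 => /IH p0 /IH sp0.
  by case: i le_i => [|i] le_i; [apply: p0 | rewrite -hs; apply: sp0].
rewrite polyev_tens (proj2 (IH _)) ?(proj2 (IH p)) ?tens0l ?addr0 // => i le_i.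
  by apply: p0; lia.
by rewrite hs; apply: p0; lia.
Qed.

Lemma opE_rels d : rels d (opE d) (opF d) (opH d).
Proof.
split.
- by rewrite liediag_bracket !delta_mulE /= subr0.
- rewrite liediag_bracket !delta_mulE /= -liediag1 -liediagZ -liediagB.
  by rewrite -E11DE22 scaler_nat opprD addrA mulr2n addrK.
- by rewrite liediag_bracket !delta_mulE /= sub0r -scaleN1r liediagZ scaleN1r.
- have : evd d (ffpoly d.+1) = 0.
    apply/polyev_eq0 => i le_i; rewrite /ffpoly horner_prod.
    rewrite (bigD1 (Ordinal (leq_ltn_trans le_i (ltnSn d)))) //= hornerXsubC.
    by rewrite subrr mul0r.
  rewrite /ffpoly /polyev rmorph_prod /= => <-; apply: eq_bigr => i _.
  by rewrite -/(polyev _ _) raddfB /= polyevX polyevC scaler_nat.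
Qed.

(** * Linear independence of the monomials *)

Lemma delta_sq0 (i j : 'I_2) :
  i != j -> delta_mx i j * delta_mx i j = 0 :> 'M[rat]_2.
Proof. by move=> ij; rewrite delta_mulE eq_sym (negPf ij). Qed.

(** Binomial expansion of two commuting terms, cut after the linear one by X^2 = 0. At k = 0 the
    junk exponent [k.-1] has coefficient zero. *)
Lemma liediag_expS d X k : X * X = 0 ->
  liediag d.+1 X ^+ k = tens (liediag d X ^+ k) 1
    + k%:R *: tens (liediag d X ^+ k.-1) X.
Proof.
move=> XX0; elim: k => [|k IH]; first by rewrite !expr0 tens1 scale0r addr0.
rewrite exprSr IH /= mulrDl !mulrDr -!scalerAl !tensM XX0 tens0r scaler0 addr0.
rewrite !mulr1 mul1r -exprSr -addrA; congr (_ + _).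
rewrite -natr1 scalerDl scale1r addrC; congr (_ + _).
by case: k {IH} => [|k]; rewrite ?scale0r // -exprSr.
Qed.

(** The three factors have the shapes that e^a, p(H) and f^c take once the last tensor factor is
    split off. *)
Lemma tens_triangular d (x x' y y' z z' : tensEnd d) (s t : rat) :
  (tens x 1 + s *: tens x' E12) * (tens y' E11 + tens y E22)
    * (tens z 1 + t *: tens z' E21)
  = tens (x * y' * z) E11 + tens (x * y * z) E22 + s *: tens (x' * y * z) E12
    + t *: tens (x * y * z') E21 + (s * t) *: tens (x' * y * z') E11.
Proof.
rewrite !mulrDl !mulrDr !mulrDl -!scalerAl -!scalerAr !tensM.
rewrite !mulr1 !mul1r !delta_mulE /= !mulr0n [0 * E21]mul0r.
rewrite !tens0r !scaler0 !add0r !mulr1n scalerA addrA.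
by congr (_ + _); rewrite addrAC.
Qed.

Lemma pmon_tens d a p c : mond d.+1 a p c =
  tens (mond d a (shift p) c) E11 + tens (mond d a p c) E22
  + a%:R *: tens (mond d a.-1 p c) E12 + c%:R *: tens (mond d a p c.-1) E21
  + (a%:R * c%:R) *: tens (mond d a.-1 p c.-1) E11.
Proof.
by rewrite /pmon /opE /opF !liediag_expS ?delta_sq0 // polyev_tens tens_triangular.
Qed.

Lemma slice_pmon i j d a p c : slice i j (mond d.+1 a p c) =
  E11 i j *: mond d a (shift p) c + E22 i j *: mond d a p c
  + (a%:R * E12 i j) *: mond d a.-1 p c + (c%:R * E21 i j) *: mond d a p c.-1
  + (a%:R * c%:R * E11 i j) *: mond d a.-1 p c.-1.
Proof.
rewrite pmon_tens.
move: (mond d _ _ _) (mond d a p c) (mond d _ _ _) (mond d _ _ _) (mond d _ _ _).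
move=> x y z w v; rewrite !(linearD, linearZ) /= !slice_tens !scalerA.
by [].
Qed.

(** Only e^a contributes E12 to the last factor, so this slice acts on monomials as a formal
    derivative in e; the next lemma does the same for f and E21. *)
Lemma slice_pmon01 d a p c :
  slice ord0 ord_max (mond d.+1 a p c) = mond d a.-1 (a%:R *: p) c.
Proof.
rewrite slice_pmon !mxE /= pmonZ.
move: (mond d _ _ _) (mond d a p c) (mond d _ _ _) (mond d _ _ _) (mond d _ _ _).
by move=> x y z w v; rewrite !mulr0 mulr1 !scale0r !addr0 !add0r.
Qed.

Lemma slice_pmon10 d a p c :
  slice ord_max ord0 (mond d.+1 a p c) = mond d a (c%:R *: p) c.-1.
Proof.
rewrite slice_pmon !mxE /= pmonZ.
move: (mond d _ _ _) (mond d a p c) (mond d _ _ _) (mond d _ _ _) (mond d _ _ _).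
by move=> x y z w v; rewrite !mulr0 mulr1 !scale0r !addr0 !add0r.
Qed.

Lemma scale_natS_eq0 n (p : polyQ) : n.+1%:R *: p = 0 -> p = 0.
Proof. by move/eqP; rewrite scaler_eq0 Num.Theory.pnatr_eq0 => /eqP. Qed.

Lemma polyev_inj d (p : polyQ) : (size p <= d.+1)%N -> evd d p = 0 -> p = 0.
Proof.
move=> sz_p /polyev_eq0 p_root; apply/eqP; apply: contraLR sz_p => p_neq0.
rewrite -ltnNge -[X in (X < _)%N](size_iota 0) -(size_map (fun i : nat => i%:R : rat)).
apply: max_poly_roots => //.
  apply/allP => x /mapP[i]; rewrite mem_iota ltnS => le_i ->; exact/eqP/p_root.
rewrite map_inj_uniq ?iota_uniq // => i j.
by move/eqP; rewrite Num.Theory.eqr_nat => /eqP.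
Qed.

(** Only the term a = c = 0 survives, a polynomial in H of degree at most d, to which [polyev_inj]
    applies. *)
Lemma pmon_indep_const d N M (P : nat -> nat -> polyQ) :
  (forall a c, size (P a c) <= d.+1 - (a + c))%N ->
  \sum_(a < N) \sum_(c < M) mond d a (P a c) c = 0 ->
  (forall a c, (0 < a + c)%N -> (a < N)%N -> (c < M)%N -> P a c = 0) ->
  forall a c, (a < N)%N -> (c < M)%N -> P a c = 0.
Proof.
move=> szP sum0 P0 a c lt_a lt_c.
have [ac0|] := posnP (a + c); last by move=> gt0; apply: P0.
have [-> ->] : a = 0%N /\ c = 0%N by lia.
apply: (@polyev_inj d); first by have := szP 0%N 0%N; rewrite subn0.
case: N M lt_a lt_c sum0 P0 => [//|N] [//|M] _ _ sum0 P0.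
have <- : mond d 0 (P 0%N 0%N) 0 = evd d (P 0%N 0%N) by rewrite /pmon mulr1 mul1r.
rewrite -[RHS]sum0 big_ord_recl [X in _ = _ + X]big1 ?addr0 => [|i _].
  rewrite big_ord_recl [X in _ = _ + X]big1 ?addr0 // => i _.
  by rewrite P0 ?pmon0.
by apply: big1 => j _; rewrite P0 ?pmon0.
Qed.

(** Induction on d. A relation for d + 1 becomes one for d under the E12 slice, which settles a > 0,
    and under the E21 slice, which settles a = 0 < c; the nonzero scalars a and c divide out. *)
Lemma pmon_indep d N M (P : nat -> nat -> polyQ) :
  (forall a c, size (P a c) <= d.+1 - (a + c))%N ->
  \sum_(a < N) \sum_(c < M) mond d a (P a c) c = 0 ->
  forall a c, (a < N)%N -> (c < M)%N -> P a c = 0.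
Proof.
elim: d N M P => [|d IH] N M P szP sum0;
  apply: (pmon_indep_const szP sum0) => a c.
(* For d = 0 the size bound is already zero when a + c > 0. *)
- by move=> ac_gt0 _ _; apply/eqP; rewrite -size_poly_leq0; have := szP a c; lia.
- case: a => [|a].
    case: c => // c _ lt_a lt_c; case: M sum0 lt_c => [//|M] sum0 lt_c.
    apply: (@scale_natS_eq0 c).
    apply: (IH N M (fun a c => c.+1%:R *: P a c.+1)) => // [a' c'|].
      by apply: leq_trans (size_scale_leq _ _) _; have := szP a' c'.+1; lia.
    have := congr1 (slice ord_max ord0) sum0; rewrite linear0 linear_sum => sum1.
    apply: (etrans _ sum1).
    apply: eq_bigr => a' _; rewrite linear_sum [RHS]big_ord_recl /= slice_pmon10.
    rewrite scale0r pmon0 add0r; apply: eq_bigr => c' _.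
    by rewrite slice_pmon10.
  move=> _ lt_a lt_c; case: N sum0 lt_a => [//|N] sum0 lt_a.
  apply: (@scale_natS_eq0 a).
  apply: (IH N M (fun a c => a.+1%:R *: P a.+1 c)) => // [a' c'|].
    by apply: leq_trans (size_scale_leq _ _) _; have := szP a'.+1 c'; lia.
  have := congr1 (slice ord0 ord_max) sum0; rewrite linear0 linear_sum => sum1.
  apply: (etrans _ sum1).
  rewrite [RHS]big_ord_recl /= linear_sum [X in _ = X + _]big1 ?add0r => [|c' _].
    apply: eq_bigr => a' _; rewrite linear_sum; apply: eq_bigr => c' _.
    by rewrite /= slice_pmon01.
  by rewrite /= slice_pmon01 scale0r pmon0.
Qed.

(** * S(2,d) as a subalgebra *)

Lemma in_schurD d (x y : tensEnd d) : in_schur x -> in_schur y -> in_schur (x + y).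
Proof.
case=> s [us ->] [t [ut ->]]; exists (s ++ t).
by rewrite all_cat us ut big_cat.
Qed.

Lemma in_schurZ d c (x : tensEnd d) : in_schur x -> in_schur (c *: x).
Proof.
case=> s [us ->]; exists [seq (c * p.1, p.2) | p <- s]; split.
  by rewrite all_map.
by rewrite scaler_sumr big_map; apply: eq_bigr => p _; rewrite scalerA.
Qed.

Lemma in_schur0 d : in_schur (0 : tensEnd d).
Proof. by exists [::]; rewrite big_nil. Qed.

Lemma in_schur_sum d I (r : seq I) (F : I -> tensEnd d) :
  (forall i, in_schur (F i)) -> in_schur (\sum_(i <- r) F i).
Proof.
by move=> schF; apply: big_ind => //; [apply: in_schur0 | apply: in_schurD].
Qed.

Lemma in_schur_tpow d g : g \in unitmx -> in_schur (tpow d g).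
Proof. by move=> ug; exists [:: (1, g)]; rewrite /= ug big_seq1 scale1r. Qed.

Lemma tpowS d g : tpow d.+1 g = tens (tpow d g) g.
Proof. by rewrite unlock. Qed.

Lemma tpow1 d : tpow d 1 = 1 :> tensEnd d.
Proof. by elim: d => // d IH; rewrite tpowS IH tens1. Qed.

Lemma tpowM d g h : (tpow d g : tensEnd d) * tpow d h = tpow d (g * h).
Proof.
elim: d => [|d IH]; first exact: mulr1.
by rewrite !tpowS tensM IH.
Qed.

Lemma in_schur1 d : in_schur (1 : tensEnd d).
Proof. by rewrite -tpow1; apply: in_schur_tpow; rewrite unitmx1. Qed.

Lemma in_schurM d (x y : tensEnd d) : in_schur x -> in_schur y -> in_schur (x * y).
Proof.
case=> s [us ->] sch_y; rewrite mulr_suml.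
elim: s us => [|p s IH] /= => [_|/andP[up us]].
  by rewrite big_nil; apply: in_schur0.
rewrite big_cons; apply: in_schurD (IH us).
rewrite -scalerAl; apply: in_schurZ; case: sch_y => t [ut ->].
rewrite mulr_sumr {IH}; elim: t ut => [|q t IH] /= => [_|/andP[uq ut]].
  by rewrite big_nil; apply: in_schur0.
rewrite big_cons; apply: in_schurD (IH ut).
rewrite -scalerAr; apply: in_schurZ; rewrite tpowM; apply: in_schur_tpow.
by rewrite unitmx_mul up uq.
Qed.

(** * S(2,d) equals the span of the monomials *)

Lemma Vandermonde_unit n (x : 'rV[rat]_n) : injective (x 0) ->
  Vandermonde n x \in unitmx.
Proof.
move=> inj_x; rewrite unitmxE det_Vandermonde unitfE.
apply/prodf_neq0 => i _; apply/prodf_neq0 => j lt_ij.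
by rewrite subr_eq0 (inj_eq inj_x) eq_sym -val_eqE neq_ltn lt_ij.
Qed.

(** A Vandermonde system at the nodes 1, ..., n; avoiding 0 keeps the diagonal matrices of
    [in_schur_opH] invertible. *)
Lemma moment_solve n (v : nat -> rat) : exists c : 'I_n -> rat,
  forall k, (k < n)%N -> \sum_(j < n) c j * j.+1%:R ^+ k = v k.
Proof.
pose x : 'rV[rat]_n := \row_j j.+1%:R.
have V_unit : Vandermonde n x \in unitmx.
  apply: Vandermonde_unit => i j; rewrite !mxE => /eqP.
  by rewrite Num.Theory.eqr_nat eqSS => /eqP/val_inj.
pose c := invmx (Vandermonde n x) *m \col_k v k.
exists (fun j => c j 0) => k lt_k.
have /matrixP/(_ (Ordinal lt_k) 0) : Vandermonde n x *m c = \col_k v k.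
  by rewrite mulmxA mulmxV // mul1mx.
by rewrite !mxE => <-; apply: eq_bigr => j _; rewrite !mxE mulrC.
Qed.

(** The transposed system at 0, ..., n - 1, which for n = d + 1 are the eigenvalues of H. *)
Lemma interpolation n (v : nat -> rat) : exists2 q : polyQ, (size q <= n)%N &
  forall i, (i < n)%N -> q.[i%:R] = v i.
Proof.
pose x : 'rV[rat]_n := \row_j j%:R.
have V_unit : Vandermonde n x \in unitmx.
  apply: Vandermonde_unit => i j; rewrite !mxE => /eqP.
  by rewrite Num.Theory.eqr_nat => /eqP/val_inj.
pose c := \row_k v k *m invmx (Vandermonde n x).
exists (rVpoly c) => [|i lt_i]; first exact: size_poly.
have /matrixP/(_ 0 (Ordinal lt_i)) : c *m Vandermonde n x = \row_k v k.
  by rewrite -mulmxA mulVmx // mulmx1.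
rewrite !mxE => <-; rewrite (horner_coef_wide _ (size_poly _ _)).
by apply: eq_bigr => j _; rewrite coef_rVpoly_ord !mxE.
Qed.

(** X can act at most once in each of the d factors. *)
Lemma liediag_nilp d X : X * X = 0 -> liediag d X ^+ d.+1 = 0.
Proof.
move=> XX0; elim: d => [|d IH]; first by rewrite expr1.
by rewrite liediag_expS //= exprSr IH mul0r !tens0l scaler0 addr0.
Qed.

Lemma tens_suml d I (r : seq I) (F : I -> tensEnd d) g :
  tens (\sum_(i <- r) F i) g = \sum_(i <- r) tens (F i) g.
Proof.
elim: r => [|i r IH]; first by rewrite !big_nil tens0l.
by rewrite !big_cons tensDl IH.
Qed.

(** As X^2 = 0, 1 + tX = exp(tX), and its tensor power is exp(t rho_d(X)), a finite sum by
    nilpotency. *)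
Lemma tpow_unip d (X : 'M[rat]_2) t : X * X = 0 -> tpow d (1 + t *: X)
  = \sum_(k < d.+1) (t ^+ k / k`!%:R) *: liediag d X ^+ k.
Proof.
move=> XX0; elim: d => [|d IH].
  by rewrite big_ord1 expr0 fact0 divr1 scale1r expr0.
rewrite tpowS; under eq_bigr do rewrite liediag_expS // scalerDr scalerA.
rewrite IH tensDr tensZr.
rewrite big_split /=; congr (_ + _).
  rewrite [RHS]big_ord_recr /= liediag_nilp // tens0l scaler0 addr0 tens_suml.
  by apply: eq_bigr => k _; rewrite tensZl.
rewrite [RHS]big_ord_recl /= mulr0 scale0r add0r tens_suml scaler_sumr.
apply: eq_bigr => k _; rewrite tensZl scalerA /bump /= add1n factS exprS natrM.
congr (_ *: _); field.
by rewrite nat1r !Num.Theory.pnatr_eq0 -lt0n fact_gt0.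
Qed.

(** The diagonal matrix acts by s^i t^(d-i) on the eigenspace H = i. The constant c absorbs the
    scalar s or t split off with each factor. *)
Lemma tpow_diag d (s t c : rat) q :
  (forall i, (i <= d)%N -> q.[i%:R] = c * s ^+ i * t ^+ (d - i)) ->
  evd d q = c *: tpow d (s *: E11 + t *: E22).
Proof.
elim: d c q => [|d IH] c q qE.
  rewrite -[evd 0 q](subrK (evd 0 c%:P)) -raddfB /= (proj2 (polyev_eq0 _ _)).
    by rewrite add0r polyevC.
  by case=> // _; rewrite hornerD hornerN hornerC qE // !expr0 !mulr1 subrr.
rewrite polyev_tens (IH (c * s)) => [|i le_i]; last first.
  rewrite horner_comp hornerD hornerX hornerC natr1 qE // subSS exprS.
  by rewrite !mulrA.
rewrite (IH (c * t)) => [|i le_i]; last first.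
  by rewrite qE ?(leqW le_i) // subSn // exprS; ring.
by rewrite tpowS tensDr !tensZr !tensZl scalerDr !scalerA.
Qed.

Lemma unip_unit (X : 'M[rat]_2) t : X * X = 0 -> 1 + t *: X \in unitmx.
Proof.
move=> XX0; suff /mulmx1_unit[] : (1 + t *: X) *m (1 - t *: X) = 1%:M by [].
change ((1 + t *: X) * (1 - t *: X) = 1).
rewrite mulrDl mul1r mulrBr mulr1 -scalerAl -scalerAr XX0 !scaler0 subr0.
by rewrite subrK.
Qed.

(** Weights with all moments zero except the first extract the linear term from the exponentials of
    [tpow_unip]. *)
Lemma in_schur_liediag d (X : 'M[rat]_2) : X * X = 0 -> in_schur (liediag d X).
Proof.
move=> XX0; have [c c_mom] := moment_solve d.+1 (fun k => (k == 1%N)%:R).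
have -> : liediag d X = \sum_(j < d.+1) c j *: tpow d (1 + j.+1%:R *: X).
  under eq_bigr do rewrite tpow_unip // scaler_sumr.
  rewrite exchange_big /=.
  transitivity (\sum_(k < d.+1) ((k == 1 :> nat)%:R / k`!%:R) *: liediag d X ^+ k).
    case: d {c c_mom} => [|d]; first by rewrite big_ord1 mul0r scale0r.
    rewrite big_ord_recl big_ord_recl /= mul0r scale0r add0r expr1 invr1 mulr1.
    by rewrite scale1r big1 ?addr0 // => i _; rewrite mul0r scale0r.
  apply: eq_bigr => k _; rewrite -c_mom // mulr_suml scaler_suml.
  by apply: eq_bigr => j _; rewrite scalerA mulrA.
apply: in_schur_sum => j; apply/in_schurZ/in_schur_tpow/unip_unit => //.
Qed.

Lemma in_schur_opE d : in_schur (opE d).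
Proof. by apply: in_schur_liediag; apply: delta_sq0. Qed.
Lemma in_schur_opF d : in_schur (opF d).
Proof. by apply: in_schur_liediag; apply: delta_sq0. Qed.

Lemma tpow_diag_poly d s t : exists2 q : polyQ, (size q <= d.+1)%N &
  evd d q = tpow d (s *: E11 + t *: E22) /\
  forall i, (i <= d)%N -> q.[i%:R] = s ^+ i * t ^+ (d - i).
Proof.
have [q sz_q qE] := interpolation d.+1 (fun i => s ^+ i * t ^+ (d - i)).
exists q => //; split=> [|i le_i]; last exact: qE.
by rewrite (@tpow_diag d s t 1) ?scale1r // => i le_i; rewrite mul1r qE.
Qed.

Lemma diag_unit (s : rat) : s != 0 -> s *: E11 + 1 *: E22 \in unitmx.
Proof.
move=> s_neq0.
suff /mulmx1_unit[] : (s *: E11 + 1 *: E22) *m (s^-1 *: E11 + 1 *: E22) = 1%:M.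
  by [].
rewrite -[RHS]/(1 : 'M[rat]_2) -E11DE22.
change ((s *: E11 + 1 *: E22) * (s^-1 *: E11 + 1 *: E22) = E11 + E22).
rewrite mulrDl !mulrDr -!scalerAl -!scalerAr !delta_mulE /= !mulr0n !mulr1n.
by rewrite !scaler0 addr0 add0r !scalerA mulfV // !scale1r.
Qed.

(** On the eigenspace H = i the matrix diag(s, 1) acts by s^i; the weights make these powers add up
    to i for every i up to d. *)
Lemma in_schur_opH d : in_schur (opH d).
Proof.
have [c c_mom] := moment_solve d.+1 (fun k => k%:R).
have -> : opH d = \sum_(j < d.+1) c j *: tpow d (j.+1%:R *: E11 + 1 *: E22).
  have /fin_all_exists2[q _ qE] : forall j : 'I_d.+1, _ :=
    fun j => tpow_diag_poly d j.+1%:R 1.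
  transitivity (evd d (\sum_(j < d.+1) c j *: q j)); last first.
    rewrite raddf_sum; apply: eq_bigr => j _.
    by rewrite /= polyevZ; have [->] := qE j.
  rewrite -[LHS]polyevX; apply/eqP; rewrite -subr_eq0; apply/eqP.
  suff : evd d ('X - \sum_(j < d.+1) c j *: q j) = 0 by rewrite raddfB.
  apply/polyev_eq0 => i le_i; rewrite hornerD hornerN hornerX horner_sum.
  apply/eqP; rewrite subr_eq0; apply/eqP; rewrite -[LHS]c_mom //.
  apply: eq_bigr => j _.
  by rewrite hornerZ; have [_ ->] := qE j; rewrite // expr1n mulr1.
apply: in_schur_sum => j; apply/in_schurZ/in_schur_tpow/diag_unit.
by rewrite Num.Theory.pnatr_eq0.
Qed.

Lemma mspan_in_schur d x : L d x -> in_schur x.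
Proof.
apply: (@mspan_subalg (tensEnd d)); [exact: in_schur1 | exact: in_schurD |
  exact: in_schurZ | exact: in_schurM | exact: in_schur_opE |
  exact: in_schur_opF | exact: in_schur_opH].
Qed.

Lemma mspan_liediag_exp d (X : 'M[rat]_2) t : X * X = 0 -> L d (liediag d X) ->
  L d (tpow d (1 + t *: X)).
Proof.
move=> XX0 LX; rewrite tpow_unip //; apply: mspan_sum => k _; apply: mspanZ.
elim: (k : nat) => [|n IH]; first exact: mspan1.
by rewrite exprS; apply: (mspan_mul (opE_rels d)).
Qed.

Lemma LDU_mx2 (g : 'M[rat]_2) : g ord0 ord0 != 0 ->
  g = (1 + (g ord_max ord0 / g ord0 ord0) *: E21)
    * (g ord0 ord0 *: E11 + (g ord_max ord_max
        - g ord_max ord0 * g ord0 ord_max / g ord0 ord0) *: E22)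
    * (1 + (g ord0 ord_max / g ord0 ord0) *: E12).
Proof.
move=> g00; apply/matrixP => i j; rewrite -!mulmxE -!idmxE.
have ord2 (k : 'I_2) : k = ord0 \/ k = ord_max.
  by case: k => [[|[|[]]] ?] //; [left | right]; apply: val_inj.
have lift0 : lift ord0 ord0 = ord_max :> 'I_2 by apply: val_inj.
rewrite !mxE !big_ord_recl !big_ord0 !mxE !big_ord_recl !big_ord0 !mxE /= !lift0.
by case: (ord2 i) => ->; case: (ord2 j) => -> /=; field.
Qed.

(** The LDU factors act as polynomials in f, H and e. Their order is not that of the monomials, but
    the span is closed under products. *)
Lemma in_schur_mspan d x : in_schur x -> L d x.
Proof.
have rel := opE_rels d; have Lmul := mspan_mul rel.
have LE t : L d (tpow d (1 + t *: E12)).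
  by apply: mspan_liediag_exp; [apply: delta_sq0 | apply: (mspan_e rel)].
have LF t : L d (tpow d (1 + t *: E21)).
  by apply: mspan_liediag_exp; [apply: delta_sq0 | apply: (mspan_f rel)].
have LD s t : L d (tpow d (s *: E11 + t *: E22)).
  have [q sz_q [<- _]] := tpow_diag_poly d s t.
  have -> : evd d q = mond d 0 q 0 by rewrite /pmon mulr1 mul1r.
  by apply: mspan_mon; rewrite !addn0.
have Lg00 (g : 'M[rat]_2) : g ord0 ord0 != 0 -> L d (tpow d g).
  move=> g00.
  rewrite (LDU_mx2 g00).
  by rewrite -!tpowM; apply: (Lmul) => //; apply: (Lmul).
case=> s [us ->]; elim: s us => [|[c g] s IH] /=; first by rewrite big_nil; left.
case/andP=> ug us; rewrite big_cons; apply: mspanD (IH us); apply: mspanZ => /=.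
have [g00|] := eqVneq (g ord0 ord0) 0; last exact: Lg00.
(* With a zero corner, adding the second row to the first gives a nonzero corner, since g is
   invertible; the left factor undoes this. *)
have -> : g = (1 + (-1) *: E12) * ((1 + 1 *: E12) * g).
  rewrite mulrA mulrDl mul1r mulrDr mulr1 -!scalerAl -scalerAr delta_mulE /=.
  by rewrite !scaler0 addr0 scale1r scaleN1r addrK mul1r.
rewrite -tpowM; apply: (Lmul) => //; apply: Lg00.
rewrite -mulmxE -idmxE !mxE !big_ord_recl big_ord0 !mxE /=.
rewrite g00 !(mulr0, mul0r, mulr1, mul1r, add0r, addr0).
apply/eqP => g10; have /matrixP/(_ ord0 ord0) := mulVmx ug.
by rewrite !mxE !big_ord_recl big_ord0 g00 g10 !mulr0 !addr0.
Qed.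

(** * Coordinates with respect to the monomials *)

Definition lincomb d (B : algType rat) (e f H : B)
    (k : 'I_d.+1 -> 'I_d.+1 -> 'I_d.+1 -> rat) : B :=
  \sum_(a < d.+1) \sum_(b < d.+1) \sum_(c < d.+1 | (a + b + c <= d)%N)
    k a b c *: (e ^+ a * H ^+ b * f ^+ c).

Lemma lincomb0 d (B : algType rat) (e f H : B) :
  lincomb e f H (fun _ _ _ : 'I_d.+1 => 0) = 0.
Proof. by do 3![apply: big1 => ? ?]; rewrite scale0r. Qed.

Lemma lincombD d (B : algType rat) (e f H : B) k k' :
  lincomb e f H (fun a b c : 'I_d.+1 => k a b c + k' a b c)
  = lincomb e f H k + lincomb e f H k'.
Proof.
rewrite -big_split; apply: eq_bigr => a _; rewrite -big_split.
apply: eq_bigr => b _; rewrite -big_split; apply: eq_bigr => c _.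
exact: scalerDl.
Qed.

Lemma lincomb_mono d (B : algType rat) (e f H : B) (a b c : 'I_d.+1) s :
  (a + b + c <= d)%N ->
  lincomb e f H (fun a' b' c' => s *+ [&& a' == a, b' == b & c' == c])
  = s *: (e ^+ a * H ^+ b * f ^+ c).
Proof.
move=> le_d; rewrite /lincomb (bigD1 a) //= (bigD1 b) //= (bigD1 c) //= !eqxx mulr1n.
rewrite !big1 ?addr0 // => [a' /negPf -> |b' /negPf ->|c' /andP[_ /negPf ->]].
- by apply: big1 => b' _; apply: big1 => c' _; rewrite scale0r.
- by apply: big1 => c' _; rewrite scale0r.
- by rewrite scale0r.
Qed.

Lemma polyevXn (B : algType rat) (H : B) n : polyev H 'X^n = H ^+ n.
Proof.
elim: n => [|n IH]; first by rewrite expr0 polyev1.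
by rewrite exprS polyevM polyevX IH exprS.
Qed.

Lemma polyev_poly (B : algType rat) (H : B) n (u : nat -> rat) :
  polyev H (\poly_(i < n) u i) = \sum_(i < n) u i *: H ^+ i.
Proof.
rewrite poly_def raddf_sum; apply: eq_bigr => i _.
by rewrite /= polyevZ polyevXn.
Qed.

Lemma mspan_lincombP d (B : algType rat) (e f H x : B) :
  mspan e f H d x <-> exists k, x = lincomb e f H (k : 'I_d.+1 -> _).
Proof.
split=> [|[k ->]]; last first.
  do 3![apply: mspan_sum => ? ?]; apply: mspanZ; rewrite -(polyevXn H).
  by apply: mspan_mon; rewrite size_polyXn addnC addnS addnAC.
elim=> [|y a p c le_d _ [k ->]].
  by exists (fun _ _ _ => 0); rewrite lincomb0.
(* For p = 0 the exponents a and c may reach d + 1, outside the index range. *)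
have [p0|p_gt0] := posnP (size p).
  exists k; move/eqP: p0; rewrite size_poly_eq0 => /eqP ->.
  by rewrite pmon0 addr0.
suff [k' ->] : exists k', pmon e f H a p c = lincomb e f H (k' : 'I_d.+1 -> _).
  by exists (fun a b c => k a b c + k' a b c); rewrite lincombD.
rewrite /pmon -[p]coefK polyev_poly mulr_sumr mulr_suml.
pose repr x := exists k', x = lincomb e f H (k' : 'I_d.+1 -> _).
apply: (@big_ind _ repr) => [|x1 x2 [k1 ->] [k2 ->]|i _].
- by exists (fun _ _ _ => 0); rewrite lincomb0.
- by exists (fun a b c => k1 a b c + k2 a b c); rewrite lincombD.
have [lt_a lt_b lt_c le_i] : [/\ a < d.+1, i < d.+1, c < d.+1 & a + i + c <= d]%N.
  by have := ltn_ord i; split; lia.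
exists (fun a' b' c' => p`_i
  *+ [&& a' == Ordinal lt_a, b' == Ordinal lt_b & c' == Ordinal lt_c]).
rewrite lincomb_mono /=; last exact: le_i.
by rewrite -scalerAr -scalerAl.
Qed.

Lemma lincomb_indep d (k : 'I_d.+1 -> 'I_d.+1 -> 'I_d.+1 -> rat) :
  lincomb (opE d) (opF d) (opH d) k = 0 ->
  forall a b c : 'I_d.+1, (a + b + c <= d)%N -> k a b c = 0.
Proof.
move=> k0 a b c le_d.
(* Powers of H are gathered for fixed a and c; truncated subtraction makes the polynomial zero when
   a + c > d. *)
pose P (a c : nat) : polyQ :=
  \poly_(b < d.+1 - (a + c)) k (inord a) (inord b) (inord c).
have P0 : \sum_(a < d.+1) \sum_(c < d.+1) mond d a (P a c) c = 0.
  rewrite -[RHS]k0; apply: eq_bigr => a' _.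
  rewrite [RHS](exchange_big_dep xpredT) //=.
  apply: eq_bigr => c' _; rewrite /pmon /P polyev_poly mulr_sumr mulr_suml.
  rewrite (big_ord_widen d.+1 (fun b => opE d ^+ a'
    * (k (inord a') (inord b) (inord c') *: opH d ^+ b) * opF d ^+ c')) ?leq_subr //.
  apply: eq_big => [b'|b' _]; first by apply/idP/idP; lia.
  by rewrite !inord_val -scalerAr -scalerAl.
have szP a' c' : (size (P a' c') <= d.+1 - (a' + c'))%N by apply: size_poly.
have := congr1 (fun p : polyQ => p`_b) (pmon_indep szP P0 (ltn_ord a) (ltn_ord c)).
rewrite coef_poly coef0 !inord_val; case: ifP => // /negP[]; lia.
Qed.

Lemma lincomb_morph d (A B : algType rat) (g : {lrmorphism A -> B}) (e f H : A) k :
  g (lincomb e f H k) = lincomb (g e) (g f) (g H) (k : 'I_d.+1 -> _).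
Proof.
do 3![rewrite linear_sum; apply: eq_bigr => ? ?].
by rewrite linearZ !rmorphM !rmorphXn.
Qed.

(** * The universal property, through a product algebra *)

Lemma rels_pair d (A B : algType rat) (e f H : A) (e' f' H' : B) :
  rels d e f H -> rels d e' f' H' ->
  rels d ((e, e') : (A * B)%type) (f, f') (H, H').
Proof.
move=> [He ef Hf P0] [He' ef' Hf' P0'].
pose p1 : {rmorphism (A * B)%type -> A} := fst.
pose p2 : {rmorphism (A * B)%type -> B} := snd.
have eq_pair (z z' : (A * B)%type) : z.1 = z'.1 -> z.2 = z'.2 -> z = z'.
  by case: z z' => [? ?] [? ?] /= -> ->.
split; apply: eq_pair => //=.
- by rewrite ef -(rmorph_nat p1).
- by rewrite ef' -(rmorph_nat p2).
- rewrite (rmorph_prod p1) -[RHS]P0 /=.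
  by apply: eq_bigr => i _; rewrite -(rmorph_nat p1).
- rewrite (rmorph_prod p2) -[RHS]P0' /=.
  by apply: eq_bigr => i _; rewrite -(rmorph_nat p2).
Qed.

Section UniversalMap.
Variables (d : nat) (B : algType rat) (e' f' H' : B).
Hypothesis rel' : rels d e' f' H'.

(* That the span in the product algebra is closed under multiplication is what
   makes the lift multiplicative, without computing structure constants. *)
Definition graph (x : tensEnd d) (y : B) : Prop :=
  @mspan (tensEnd d * B)%type (opE d, e') (opF d, f') (opH d, H') d (x, y).

(** The pair (0, y - y') is a combination of monomial pairs; independence in the first component
    makes its coefficients vanish. *)
Lemma graph_fun x y y' : graph x y -> graph x y' -> y = y'.
Proof.
move=> Gy Gy'; have := mspanB Gy Gy'; case/mspan_lincombP=> k eq_k.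
have k0 : lincomb (opE d) (opF d) (opH d) k = 0.
  have := congr1 (fst : {lrmorphism (tensEnd d * B)%type -> tensEnd d}) eq_k.
  by rewrite lincomb_morph /= subrr.
have := congr1 (snd : {lrmorphism (tensEnd d * B)%type -> B}) eq_k.
rewrite lincomb_morph /= /lincomb big1 => [/eqP|a _].
  by rewrite subr_eq0 => /eqP.
apply: big1 => b _; apply: big1 => c le_d.
by rewrite (lincomb_indep k0) // scale0r.
Qed.

(** The coefficients that express x are reused in B. *)
Lemma graph_total x : in_schur x -> exists y, graph x y.
Proof.
case/in_schur_mspan/mspan_lincombP=> k ->; exists (lincomb e' f' H' k).
apply/mspan_lincombP; exists k.
have := lincomb_morph (fst : {lrmorphism (tensEnd d * B)%type -> tensEnd d})
  (opE d, e') (opF d, f') (opH d, H') k.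
have := lincomb_morph (snd : {lrmorphism (tensEnd d * B)%type -> B})
  (opE d, e') (opF d, f') (opH d, H') k.
by case: (lincomb (_, _) _ _ _) => /= ? ? -> ->.
Qed.

(** Chosen on all matrices; outside S(2,d) the value is arbitrary, and [schur_hom] constrains
    nothing there. *)
Definition schur_lift (x : 'M[rat]_(2 ^ d)) : B := epsilon (inhabits 0) (graph x).

Lemma schur_liftP x : in_schur x -> graph x (schur_lift x).
Proof. by move=> /graph_total; apply: epsilon_spec. Qed.

Lemma schur_lift_eq x y : graph x y -> schur_lift x = y.
Proof.
move=> Gxy; apply: graph_fun (Gxy).
by apply: epsilon_spec; exists y.
Qed.

Let relp := rels_pair (opE_rels d) rel'.

Lemma graph1 : graph 1 1. Proof. exact: mspan1. Qed.
Lemma graphD x y u v : graph x u -> graph y v -> graph (x + y) (u + v).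
Proof. by move=> Gx Gy; exact: (mspanD Gx Gy). Qed.
Lemma graphZ s x u : graph x u -> graph (s *: x) (s *: u).
Proof. by move=> Gx; exact: (mspanZ s Gx). Qed.
Lemma graphM x y u v : graph x u -> graph y v -> graph (x * y) (u * v).
Proof. by move=> Gx Gy; exact: (mspan_mul relp Gx Gy). Qed.
Lemma graphE : graph (opE d) e'. Proof. exact: mspan_e relp. Qed.
Lemma graphF : graph (opF d) f'. Proof. exact: mspan_f relp. Qed.
Lemma graphH : graph (opH d) H'. Proof. exact: mspan_H relp. Qed.

Lemma schur_lift_hom : schur_hom schur_lift.
Proof.
split=> [|x y sx sy|c x sx|x y sx sy]; apply: schur_lift_eq.
- exact: graph1.
- by apply: graphD; apply: schur_liftP.
- by apply: graphZ; apply: schur_liftP.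
- by apply: graphM; apply: schur_liftP.
Qed.

(** Uniqueness: the x with (x, psi x) in the graph form a subalgebra containing the generators.
    Membership in S(2,d) is carried along because psi is only known to respect operations there. *)
Lemma schur_hom_graph (psi : 'M[rat]_(2 ^ d) -> B) :
  schur_hom psi -> psi (opE d) = e' -> psi (opF d) = f' -> psi (opH d) = H' ->
  forall x, in_schur x -> graph x (psi x).
Proof.
case=> psi1 psiD psiZ psiM psiE psiF psiH x sch_x.
suff [] : in_schur x /\ graph x (psi x) by [].
move: x {sch_x} (in_schur_mspan sch_x).
apply: (@mspan_subalg (tensEnd d))
  => [|x y [sx Gx] [sy Gy]|s x [sx Gx]|x y [sx Gx] [sy Gy]|||].
- by split; [apply: in_schur1 | rewrite psi1; apply: graph1].
- by split; [apply: in_schurD | rewrite psiD //; apply: graphD].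
- by split; [apply: in_schurZ | rewrite psiZ //; apply: graphZ].
- split; [exact: in_schurM | rewrite -[x * y]/(x *m y) psiM //; exact: graphM].
- by split; [apply: in_schur_opE | rewrite psiE; apply: graphE].
- by split; [apply: in_schur_opF | rewrite psiF; apply: graphF].
- by split; [apply: in_schur_opH | rewrite psiH; apply: graphH].
Qed.

End UniversalMap.

(** * The presentation and the basis in matrix form *)

Lemma mxpowE d (x : tensEnd d) k : mxpow x k = x ^+ k.
Proof. by elim: k => [//|k IH]; rewrite exprS -IH. Qed.

Lemma mono_lincomb d k :
  \sum_(a < d.+1) \sum_(b < d.+1) \sum_(c < d.+1 | (a + b + c <= d)%N)
     k a b c *: mono (opE d) (opF d) (opH d) a b c
  = lincomb (opE d) (opF d) (opH d) k.
Proof.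
do 3![apply: eq_bigr => ? ?].
by rewrite /mono !mxpowE.
Qed.

Lemma opE_mx_rels d : mx_rels (opE d) (opF d) (opH d).
Proof.
have natE n : (n%:R : tensEnd d) = n%:R%:M.
  by rewrite -[LHS]scaler_nat; exact: scalemx1.
have [He ef Hf P0] := opE_rels d; split=> //.
  by rewrite -natE.
by rewrite -[RHS]P0; apply: eq_bigr => i _; rewrite -natE.
Qed.

Theorem theorem2p2 (d : nat) :
  exists e f H : 'M[rat]_(2 ^ d),
    [/\ in_schur e, in_schur f, in_schur H & mx_rels e f H] /\
        (* universal property: S(2,d) is the Q-algebra presented by e, f, H *)
        (forall (B : algType rat) (e' f' H' : B), rels d e' f' H' ->
           exists phi : 'M[rat]_(2 ^ d) -> B,
             [/\ schur_hom phi, phi e = e', phi f = f', phi H = H' &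
                 forall psi : 'M[rat]_(2 ^ d) -> B,
                   schur_hom psi -> psi e = e' -> psi f = f' -> psi H = H' ->
                   forall x, in_schur x -> psi x = phi x]) /\
        (* the monomials e^a H^b f^c, a+b+c <= d, are linearly independent *)
        (forall k : 'I_d.+1 -> 'I_d.+1 -> 'I_d.+1 -> rat,
           \sum_(a < d.+1) \sum_(b < d.+1) \sum_(c < d.+1 | (a + b + c <= d)%N)
              k a b c *: mono e f H a b c = 0 ->
           forall a b c : 'I_d.+1, (a + b + c <= d)%N -> k a b c = 0) /\
        (* ... and span S(2,d) *)
        (forall x, in_schur x <->
           exists k : 'I_d.+1 -> 'I_d.+1 -> 'I_d.+1 -> rat,
             x = \sum_(a < d.+1) \sum_(b < d.+1) \sum_(c < d.+1 | (a + b + c <= d)%N)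
                   k a b c *: mono e f H a b c).
Proof.
exists (opE d), (opF d), (opH d); split; [|split; [|split]].
- split; [exact: in_schur_opE | exact: in_schur_opF | exact: in_schur_opH |].
  exact: opE_mx_rels.
- move=> B e' f' H' rel'; exists (schur_lift e' f' H'); split.
  + exact: schur_lift_hom.
  + by apply: schur_lift_eq; apply: graphE.
  + by apply: schur_lift_eq; apply: graphF.
  + by apply: schur_lift_eq; apply: graphH.
  + move=> psi hom psiE psiF psiH x sch_x.
    by apply/esym/schur_lift_eq; apply: schur_hom_graph.
- by move=> k; rewrite mono_lincomb; apply: lincomb_indep.
- move=> x; split=> [/in_schur_mspan/mspan_lincombP[k ->]|[k ->]].
    by exists k; rewrite mono_lincomb.
  by rewrite mono_lincomb; apply/mspan_in_schur/mspan_lincombP; exists k.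
Qed.
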